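(* Let $(\Omega,\mathcal{B},\nu,T)$ be a one-dimensional dynamical system: $\Omega\subset\mathbb{R}$ with Borel $\sigma$-algebra $\mathcal{B}$, $T:\Omega\to\Omega$ measurable, and $\nu$ a $T$-invariant Borel probability measure. Let $S=[-1,1]$, let $\theta$ be the (normalized) Lebesgue measure on $S$, let $\varepsilon>0$, and let $z\in\Omega$ with $\nu(B(z,\varepsilon))>0$. On $\Omega\times S^{\mathbb{N}}$ with the probability $\mathbb{P}=\nu\times\theta^{\mathbb{N}}$ consider the process $$X_m(x,\overline{\xi})=-\log\big|T^m x+\varepsilon\,\Pi_m(\overline{\xi})-z\big|,\qquad m\ge 0,$$ and suppose that it verifies a Gumbel law. Then the linear sequence $u_m=u/a_m+b_m$, with $u=-\log\tau$, for which $$m\,\mathbb{P}(X_0>u_m)\to\tau\quad\text{as } m\to\infty\qquad(\tau>0),$$ is given by $$a_m=1,\qquad b_m=\log\left(\frac{m\,\nu(B(z,\varepsilon))}{\varepsilon}\right);$$ that is, with these $a_m,b_m$, for every $\tau>0$ the levels $u_m=-\log\tau+b_m$ satisfy $m\,\mathbb{P}(X_0>u_m)\to\tau$.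
   Context: $\overline{\xi}=(\xi_0,\xi_1,\dots)\in S^{\mathbb{N}}$ and $\Pi_m(\overline{\xi})=\xi_m$ is the projection on the $m$-th component. $B(z,\varepsilon)$ is the ball of center $z$ and radius $\varepsilon$. ''$X_0,X_1,\dots$ verifies a Gumbel law'' means: writing $M_m=\max\{X_0,\dots,X_{m-1}\}$, for every $\tau>0$ there is a sequence of levels $u_m=u_m(\tau)$ with $m\,\mathbb{P}(X_0>u_m)\to\tau$ and $\mathbb{P}(M_m\le u_m)\to e^{-\tau}$ as $m\to\infty$.
   Formalization: The hypothesis ν({x : |x − z| = ε}) = 0 is added; without it the claim fails (e.g. Ω = {z, z+ε}, T the swap, ν uniform gives limit 3τ/2, or 3τ/4 with closed balls), and the conclusion holds exactly when this sphere is ν-null. *)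

(* Defs.v *)
From HB Require Import structures.
From mathcomp Require Export all_boot all_order all_algebra.
From mathcomp Require Export all_classical all_reals all_analysis.
Export Order.TTheory GRing.Theory Num.Theory.
Export numFieldNormedType.Exports.

Set Implicit Arguments.
Unset Strict Implicit.
Unset Printing Implicit Defensive.

Local Open Scope classical_set_scope.
Local Open Scope ring_scope.

(* The subset [A] of the line, as a type of its own.  Measurable types are
   pointed, whence the base point [a], which plays no other role. *)
Definition pointed_subset (R : realType) (A : set R) (a : A) : Type := A.

HB.instance Definition _ (R : realType) (A : set R) (a : A) :=
  Choice.copy (pointed_subset a) {x : R | x \in A}.
HB.instance Definition _ (R : realType) (A : set R) (a : A) :=
  isPointed.Build (pointed_subset a) a.

Definition incl (R : realType) (A : set R) (a : A) (x : pointed_subset a) : R :=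
  sval x.
Arguments incl {R A} a x.

(* [A] with its Borel (trace) sigma-algebra: the sets [A `&` B], B Borel. *)
Notation borel_subset a := (g_sigma_algebra_preimageType (incl a)).

Section noise.
Variable R : realType.

Lemma noise_origin_proof : (0 : R) \in [set` `[(-1 : R), 1]].
Proof. by rewrite inE /= in_itv /= lerN10 ler01. Qed.

Definition noise_origin : [set` `[(-1 : R), 1]] :=
  exist _ 0 noise_origin_proof.

End noise.

Notation noise R := (borel_subset (noise_origin R)).

Section theta.
Context {R : realType}.

Definition noise_val (xi : noise R) : R := incl (noise_origin R) xi.

Lemma image_noise_val_preimage (B : set R) :
  noise_val @` (noise_val @^-1` B) = B `&` `[-1, 1].
Proof.
apply/seteqP; split => [_ [xi Bxi <-]|x [Bx x1]] /=.
  by split => //; have := valP xi; rewrite inE.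
by exists (exist _ x (mem_set x1)).
Qed.

Lemma measurable_image_noise_val (A : set (noise R)) :
  measurable A -> measurable (noise_val @` A).
Proof.
move=> [B mB <-]; rewrite setTI image_noise_val_preimage.
exact: measurableI.
Qed.

Definition theta (A : set (noise R)) : \bar R :=
  ((2^-1)%:E * lebesgue_measure (noise_val @` A))%E.

Let theta0 : theta set0 = 0%E.
Proof. by rewrite /theta image_set0 measure0 mule0. Qed.

Let theta_ge0 A : (0 <= theta A)%E.
Proof. by rewrite mule_ge0// lee_fin invr_ge0. Qed.

Let theta_sigma_additive : semi_sigma_additive theta.
Proof.
move=> F mF tF mUF; rewrite /theta image_bigcup.
under eq_fun do rewrite -ge0_sume_distrr//.
apply: cvgeZl => //; apply: measure_semi_sigma_additive.
- by move=> i; exact: measurable_image_noise_val.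
- apply/trivIsetP => i j _ _ ij; rewrite -subset0 => _ [[x Fx <-] [y Fy]].
  move=> /val_inj yx; move/trivIsetP : tF => /(_ i j Logic.I Logic.I ij).
  by rewrite -subset0 => /(_ x); apply; split => //; rewrite -yx.
- by rewrite -image_bigcup; exact: measurable_image_noise_val.
Qed.

HB.instance Definition _ := isMeasure.Build _ _ _ theta
  theta0 theta_ge0 theta_sigma_additive.

Let theta_setT : theta [set: noise R] = 1%E.
Proof.
rewrite /theta -(preimage_setT noise_val) image_noise_val_preimage setTI.
rewrite lebesgue_measure_itv/= lte_fin gtrN// -EFinD opprK -EFinM.
by rewrite mulVf.
Qed.

HB.instance Definition _ := Measure_isProbability.Build _ _ _ theta theta_setT.

End theta.

Section infinite_product.
Context {d : measure_display} {W : measurableType d}.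

Definition coordinate (m : nat) (xi : nat -> W) : W := xi m.

Definition cylinders : set (set (nat -> W)) :=
  [set C | exists m, exists2 A, measurable A & C = coordinate m @^-1` A].

End infinite_product.
Arguments cylinders {d} W.

(* [W^nat] with the product sigma-algebra. *)
Notation seq_space W := (g_sigma_algebraType (cylinders W)).

(* [muN] is the infinite product of copies of [mu].  This property determines
   [muN]: the boxes below are stable under intersection and generate the
   product sigma-algebra. *)
Definition is_infinite_product (R : realType) (d : measure_display)
    (W : measurableType d) (mu : probability W R)
    (muN : probability (seq_space W) R) : Prop :=
  forall (n : nat) (A : nat -> set W), (forall i, measurable (A i)) ->
    muN [set xi | forall i, (i < n)%N -> A i (coordinate i xi)] =
    (\prod_(i < n) mu (A i))%E.

Section extremes.
Context {R : realType} {d : measure_display} {W : measurableType d}.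
Local Open Scope ereal_scope.

Definition exceedance (X : nat -> W -> \bar R) (v : R) : set W :=
  [set w | v%:E < X 0%N w].

Definition partial_max (X : nat -> W -> \bar R) (m : nat) (w : W) : \bar R :=
  \big[maxe/-oo]_(i < m) X i w.

Definition level_of_frequency (P : {measure set W -> \bar R})
    (X : nat -> W -> \bar R) (tau : R) (u : nat -> R) : Prop :=
  m%:R%:E * P (exceedance X (u m)) @[m --> \oo] --> tau%:E.

Definition gumbel_law (P : {measure set W -> \bar R})
    (X : nat -> W -> \bar R) : Prop :=
  forall tau : R, (0 < tau)%R -> exists u : nat -> R,
    level_of_frequency P X tau u /\
    P [set w | partial_max X m w <= (u m)%:E] @[m --> \oo]
      --> (expR (- tau))%:E.

End extremes.

Definition invariant_measure (R : realType) (d : measure_display)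
    (W : measurableType d) (nu : probability W R) (T : W -> W) : Prop :=
  forall A, measurable A -> nu (T @^-1` A) = nu A.

(* Extended-real valued, as it is [+oo] where the noisy orbit hits [z]. *)
Definition observation (R : realType) (Omega : set R) (z : Omega)
    (T : borel_subset z -> borel_subset z) (eps : R) (m : nat)
    (w : borel_subset z * seq_space (noise R)) : \bar R :=
  (- lne `|incl z (iter m T w.1) + eps * noise_val (coordinate m w.2)
           - sval z|%:E)%E.

Definition ball_around (R : realType) (Omega : set R) (z : Omega) (eps : R) :
    set (borel_subset z) :=
  [set x | ball (sval z) eps (incl z x)].

(* A point [x] at distance exactly [eps] from [z] has its noisy image within
   [r] of [z] with probability [r / (2 * eps)] only, against [r / eps] inside
   the ball (for small [r]), so an atom there matters: it counts for one half
   in the exceedance probabilities, with open balls as with closed ones. *)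
Definition sphere_around (R : realType) (Omega : set R) (z : Omega) (eps : R) :
    set (borel_subset z) :=
  [set x | `|incl z x - sval z| = eps].

Arguments ball_around {R Omega} z eps.
Arguments sphere_around {R Omega} z eps.

Definition linear_level (R : realType) (a b : nat -> R) (tau : R) (m : nat) : R :=
  - ln tau / a m + b m.

(* Main.v *)
(** For [m >= 1] the event [X_0 > u_m] says that [x + eps * xi_0] lies within
    [tau * eps / (m * p)] of [z], where [p = nu (B(z, eps))].  At fixed [x] this
    is the event that the uniform variable [xi_0] falls in a ball of radius
    [tau / (m * p)] around [c = (z - x) / eps].  Its probability is at most
    [tau / (m * p)], with equality for large [m] when [|c| < 1], and it vanishes
    for large [m] when [|c| > 1]; the case [|c| = 1] is [nu]-negligible.
    Multiplying by [m] and integrating over [x], dominated convergence gives the limit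
    [(tau / p) * nu (B(z, eps)) = tau]. *)
Require Import Defs.
From mathcomp Require Import ring lra measurable_realfun.
Set Implicit Arguments.
Unset Strict Implicit.
Unset Printing Implicit Defensive.
Local Open Scope classical_set_scope.
Local Open Scope ring_scope.

Lemma measurable_incl (R : realType) (A : set R) (a : A) :
  measurable_fun [set: borel_subset a] (incl a : borel_subset a -> R).
Proof. by move=> _ B mB; exists B. Qed.

Lemma measurable_noise_val (R : realType) :
  measurable_fun [set: noise R] (@noise_val R).
Proof. by move=> _ B mB; exists B. Qed.

Lemma measurable_coordinate d (W : measurableType d) (m : nat) :
  measurable_fun [set: seq_space W] (coordinate m : seq_space W -> W).
Proof.
move=> _ A mA; rewrite setTI; apply: sub_sigma_algebra.
by exists m, A.
Qed.

(** * Small balls under the uniform law on [[-1, 1]] *)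

Section uniform_noise.
Variable R : realType.
Implicit Types c r s : R.

Definition noise_ball c r : set (noise R) := @noise_val R @^-1` ball c r.

Lemma measurable_noise_ball c r : measurable (noise_ball c r).
Proof.
by rewrite -[noise_ball c r]setTI; apply: measurable_noise_val => //;
  exact: measurable_ball.
Qed.

Lemma theta_noise_ballE c r : theta (noise_ball c r) =
  ((2^-1)%:E * lebesgue_measure (ball c r `&` `[(-1)%R, 1%R]))%E.
Proof. by rewrite /theta image_noise_val_preimage. Qed.

(** Cutting the ball down to [[-1, 1]] only loses length. The bound is uniform in the center, which
    is what domination will require. *)
Lemma theta_noise_ball_le c r : 0 <= r -> (theta (noise_ball c r) <= r%:E)%E.
Proof.
move=> r0; rewrite theta_noise_ballE.
(* The ball has length [2 * r], and the normalization of [theta] halves it. *)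
have -> : r%:E = ((2^-1)%:E * lebesgue_measure (ball c r))%E.
  by rewrite lebesgue_measure_ball// -EFinM; congr EFin; field.
apply: lee_wpmul2l; first by rewrite lee_fin invr_ge0.
apply: le_measure; rewrite ?inE//; last exact: measurable_ball.
by apply: measurableI => //; exact: measurable_ball.
Qed.

Lemma theta_noise_ball_sub c r : 0 <= r -> `|c| + r <= 1 ->
  theta (noise_ball c r) = r%:E.
Proof.
move=> r0 cr1; rewrite theta_noise_ballE setIidl.
  by rewrite lebesgue_measure_ball// -EFinM; congr EFin; field.
move=> y; rewrite /ball/= in_itv/= => cyr; rewrite -ler_norml.
have -> : y = c - (c - y) by ring.
by apply: le_trans (ler_normB _ _) _; lra.
Qed.

Lemma theta_noise_ball_disjoint c r : 1 + r <= `|c| ->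
  theta (noise_ball c r) = 0%E.
Proof.
move=> rc; rewrite theta_noise_ballE.
have -> : ball c r `&` `[-1, 1]%classic = set0.
  apply/seteqP; split => // y [] /=; rewrite /ball/= in_itv/= -ler_norml.
  move=> cyr y1; have := ler_normD (c - y) y; rewrite subrK; lra.
by rewrite measure0 mule0.
Qed.

(** The sequence is eventually constant: once the radius is at most the gap between [|c|] and 1, the
    ball lies inside [[-1, 1]] or misses it. At [|c| = 1] half of each small ball would remain, with
    limit [s / 2]. *)
Lemma cvg_scaled_theta_noise_ball c s : 0 <= s -> `|c| != 1 ->
  (n.+1%:R%:E * theta (noise_ball c (s / n.+1%:R)))%E @[n --> \oo] -->
  (s * (`|c| < 1)%R%:R)%:E.
Proof.
move=> s0 c1.
have near_small (e : R) : 0 < e -> \forall n \near \oo, s / n.+1%:R <= e.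
  move=> e0; have : s * n.+1%:R^-1 @[n --> \oo] --> s * 0.
    by apply: cvgM; [exact: cvg_cst|exact: cvg_harmonic].
  rewrite mulr0 => /cvgr0_norm_le /(_ _ e0).
  by apply: filterS => n /=; apply: le_trans; exact: ler_norm.
apply: cvg_near_cst; case: ltP c1 => [c1 _|c1 cn1].
  have c1' : 0 < 1 - `|c| by lra.
  have := near_small _ c1'; apply: filterS => n /= sn.
  rewrite theta_noise_ball_sub; [|by rewrite divr_ge0|by rewrite -lerBrDl].
  by rewrite -EFinM mulr1 mulrC divfK.
have c1' : 0 < `|c| - 1 by rewrite subr_gt0 lt_neqAle eq_sym cn1.
have := near_small _ c1'; apply: filterS => n /= sn.
by rewrite theta_noise_ball_disjoint ?mule0 ?mulr0// -lerBrDl.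
Qed.

End uniform_noise.

Lemma infinite_product_coordinate0 (R : realType) d (W : measurableType d)
    (mu : probability W R) (muN : probability (seq_space W) R) (A : set W) :
  is_infinite_product mu muN -> measurable A ->
  muN (coordinate 0 @^-1` A) = mu A.
Proof.
(* The box with one constrained side is the cylinder over [A]. *)
move=> muNE mA; have := muNE 1%N (fun=> A) (fun=> mA).
rewrite big_ord1 => <-; congr (muN _).
by apply/seteqP; split => [xi Axi [|]//|xi /(_ 0%N isT)].
Qed.

Lemma ltNlne (R : realType) (v y : R) : 0 <= y ->
  (v%:E < - lne y%:E)%E = (y < expR (- v)).
Proof.
rewrite le_eqVlt => /predU1P[<-|y0].
  (* At [y = 0] the value [- lne 0] is [+oo], above every level, while [expR (- v)] is positive:
     both sides hold. *)
  by rewrite /lne lexx/= ltry expR_gt0.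
by rewrite lne_EFin// -EFinN lte_fin ltrNr -[in RHS](lnK y0) ltr_expR.
Qed.

(** * The exceedance event and its sections at a fixed initial point *)

Section noisy_orbit.
Variables (R : realType) (Omega : set R) (z : Omega) (eps : R).
Hypothesis eps_gt0 : 0 < eps.

(** The noise value, possibly outside [[-1, 1]], that would carry [x] exactly to [z]. *)
Definition noise_center (x : borel_subset z) : R := (sval z - incl z x) / eps.

Definition noisy_hit (r : R) :
    set (borel_subset z * seq_space (noise R)) :=
  [set w | `|incl z w.1 + eps * noise_val (coordinate 0 w.2) - sval z| < r].

Lemma exceedance_observation (T : borel_subset z -> borel_subset z) (v : R) :
  exceedance (observation T eps) v = noisy_hit (expR (- v)).
Proof.
by apply/seteqP; split => w; rewrite /exceedance /noisy_hit /observation /=;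
  rewrite ltNlne.
Qed.

Lemma measurable_noisy_hit (r : R) : measurable (noisy_hit r).
Proof.
have mf : measurable_fun [set: borel_subset z * seq_space (noise R)]
    (fun w => `|incl z w.1 + eps * noise_val (coordinate 0 w.2) - sval z|).
  apply: measurableT_comp => //; apply: measurable_funB => //.
  apply: measurable_funD.
    exact: (measurableT_comp (@measurable_incl _ _ z)).
  apply: measurable_funM => //.
  apply: (measurableT_comp (@measurable_noise_val R)).
  exact: (measurableT_comp (@measurable_coordinate _ _ 0)).
rewrite [noisy_hit r](_ : _ = setT `&` (fun w =>
    `|incl z w.1 + eps * noise_val (coordinate 0 w.2) - sval z|) @^-1`
      `]-oo, r[%classic); first exact: mf.
by rewrite setTI; apply/seteqP; split => w /=; rewrite in_itv.
Qed.

(** With [c] the center, [x + eps * xi_0 - z = eps * (xi_0 - c)], so dividing by [eps] leaves a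
    condition on the coordinate [xi_0] alone. *)
Lemma xsection_noisy_hit (r : R) (x : borel_subset z) :
  xsection (noisy_hit r) x =
  coordinate 0 @^-1` noise_ball (noise_center x) (r / eps).
Proof.
have distE (xi : seq_space (noise R)) :
    `|incl z x + eps * noise_val (coordinate 0 xi) - sval z| =
    `|noise_center x - noise_val (coordinate 0 xi)| * eps.
  rewrite -[eps in RHS](gtr0_norm eps_gt0) -normrM distrC.
  by congr `|_|; rewrite /noise_center; field; rewrite gt_eqF.
by apply/seteqP; split => xi;
  rewrite /xsection/= inE /noisy_hit /noise_ball /ball/= distE -ltr_pdivlMr.
Qed.

Lemma norm_noise_center (x : borel_subset z) :
  `|noise_center x| = `|incl z x - sval z| / eps.
Proof. by rewrite normrM normfV distrC (gtr0_norm eps_gt0). Qed.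

Lemma norm_noise_center_lt1 (x : borel_subset z) :
  (`|noise_center x| < 1)%R%:R = \1_(ball_around z eps) x :> R.
Proof.
rewrite norm_noise_center ltr_pdivrMr// mul1r distrC indicE.
by congr ((nat_of_bool _)%:R); apply/idP/idP; rewrite inE.
Qed.

Lemma norm_noise_center_neq1 (x : borel_subset z) :
  ~ sphere_around z eps x -> `|noise_center x| != 1.
Proof.
move=> xS; apply/eqP; rewrite norm_noise_center => /divr1_eq.
exact: xS.
Qed.

Lemma measurable_ball_around : measurable (ball_around z eps).
Proof.
exists (ball (sval z) eps); first exact: measurable_ball.
by rewrite setTI.
Qed.

Lemma measurable_sphere_around : measurable (sphere_around z eps).
Proof.
exists [set y | `|y - sval z| = eps]; last by rewrite setTI.
rewrite [X in measurable X](_ : _ =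
   setT `&` (fun y => `|y - sval z|) @^-1` [set eps]).
  have : measurable_fun [set: R] (fun y => `|y - sval z|).
    by apply: measurableT_comp => //; exact: measurable_funB.
  by apply.
by rewrite setTI.
Qed.

(** * Passage to the limit under the integral over the initial point *)

Variables (nu : probability (borel_subset z) R)
  (thetaN : probability (seq_space (noise R)) R).
Hypothesis thetaN_product : is_infinite_product theta thetaN.
Hypothesis nu_sphere0 : nu (sphere_around z eps) = 0%E.

Lemma thetaN_xsection_noisy_hit (r : R) (x : borel_subset z) :
  thetaN (xsection (noisy_hit r) x) =
  theta (noise_ball (noise_center x) (r / eps)).
Proof.
rewrite xsection_noisy_hit.
apply: infinite_product_coordinate0 => //; exact: measurable_noise_ball.
Qed.

Lemma cvg_scaled_noisy_hit (s : R) : 0 <= s ->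
  (n.+1%:R%:E * (nu \x thetaN)%E (noisy_hit (s * eps / n.+1%:R)))%E
    @[n --> \oo] -->
  (s%:E * nu (ball_around z eps))%E.
Proof.
move=> s0.
pose r (n : nat) : R := s * eps / n.+1%:R.
have rE n : r n / eps = s / n.+1%:R.
  by rewrite /r mulrAC mulfK ?gt_eqF.
pose f n x := (n.+1%:R%:E * thetaN (xsection (noisy_hit (r n)) x))%E.
have mx n : measurable_fun [set: borel_subset z]
    (fun x => thetaN (xsection (noisy_hit (r n)) x)).
  exact: (measurable_fun_xsection thetaN (measurable_noisy_hit (r n))).
have mf n : measurable_fun [set: borel_subset z] (f n).
  exact: emeasurable_funM.
pose g (x : borel_subset z) := (s * \1_(ball_around z eps) x)%:E.
have mg : measurable_fun [set: borel_subset z] g.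
  apply/measurable_EFinP/measurable_funM => //.
  exact/measurable_indic/measurable_ball_around.
have fg : {ae nu, forall x, [set: borel_subset z] x ->
    f ^~ x @ \oo --> g x}.
  (* Pointwise convergence can fail only where the center has norm 1, that is on the sphere, which
     is [nu]-null. *)
  exists (sphere_around z eps); split => //.
    exact: measurable_sphere_around.
  move=> x /=; apply: contra_notP => xS _.
  rewrite /g -norm_noise_center_lt1.
  under eq_fun do rewrite /f thetaN_xsection_noisy_hit rE.
  exact/cvg_scaled_theta_noise_ball/norm_noise_center_neq1.
have fs : {ae nu, forall x n, [set: borel_subset z] x ->
    (`|f n x| <= (cst s%:E) x)%E}.
  apply: aeW => x n _; rewrite gee0_abs; last by rewrite mule_ge0.
  rewrite /f thetaN_xsection_noisy_hit rE.
  apply: (@le_trans _ _ (n.+1%:R%:E * (s / n.+1%:R)%:E)%E).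
    by rewrite lee_wpmul2l// theta_noise_ball_le// divr_ge0.
  by rewrite -EFinM mulrC divfK.
have ints : nu.-integrable [set: borel_subset z] (cst s%:E).
  exact: finite_measure_integrable_cst.
have [_ _ intf] := dominated_convergence measurableT mf mg fg ints fs.
have intg : (\int[nu]_x g x = s%:E * nu (ball_around z eps))%E.
  rewrite /g; under eq_integral do rewrite EFinM.
  rewrite ge0_integralZl//.
  - by rewrite integral_indic ?setIT//; exact: measurable_ball_around.
  - exact/measurable_EFinP/measurable_indic/measurable_ball_around.
rewrite -intg; apply: cvg_trans intf; apply: near_eq_cvg; apply: nearW => n /=.
(* Once the factor [n.+1] is pulled out, the integral of the section measures is the product measure
   by definition. *)
by rewrite /f ge0_integralZl.
Qed.

End noisy_orbit.

Theorem proposition2 (R : realType) (Omega : set R) (z : Omega)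
  (nu : probability (borel_subset z) R)
  (T : borel_subset z -> borel_subset z)
  (thetaN : probability (seq_space (noise R)) R) (eps : R)
  (measurable_T : measurable_fun [set: borel_subset z] T)
  (invariant_nu : invariant_measure nu T)
  (thetaN_product : is_infinite_product theta thetaN)
  (eps_gt0 : 0 < eps)
  (nu_ball_gt0 : (0 < nu (ball_around z eps))%E)
  (nu_sphere0 : nu (sphere_around z eps) = 0%E)
  (gumbel : gumbel_law (nu \x thetaN)%E (observation T eps)) :
  let a := fun _ : nat => 1 in
  let b := fun m : nat => ln (m%:R * fine (nu (ball_around z eps)) / eps) in
  forall tau : R, 0 < tau ->
    level_of_frequency (nu \x thetaN)%E (observation T eps) tau
      (linear_level a b tau).
Proof.
move=> a b tau tau0.
set p := fine (nu (ball_around z eps)) in b *.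
have pE : nu (ball_around z eps) = p%:E.
  by rewrite fineK// fin_num_measure//; exact: measurable_ball_around.
have p0 : 0 < p by rewrite -lte_fin -pE.
(* The shift drops the index 0, where [b 0] is the default value of [ln] at 0. *)
rewrite /level_of_frequency -cvg_shiftS.
(* The choice [s = tau / p] makes the limit [s * p] equal to [tau]. *)
have s0 : 0 <= tau / p by rewrite divr_ge0// ltW.
have hit := cvg_scaled_noisy_hit eps_gt0 thetaN_product nu_sphere0 s0.
rewrite pE -EFinM divfK ?gt_eqF// in hit.
apply: cvg_trans hit; apply: near_eq_cvg; apply: nearW => n.
rewrite /= exceedance_observation; congr (_ * (_ \x _)%E (noisy_hit _ _))%E.
(* It remains to match radii: exponentiating minus the level gives [tau * eps / (n.+1 * p)], which
   is [s * eps / n.+1]. *)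
rewrite /linear_level /a /b divr1 opprD opprK expRD expRN.
rewrite !lnK ?posrE//; last by rewrite divr_gt0// mulr_gt0.
by field; rewrite !gt_eqF.
Qed.
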